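(* For every complex number $q$ with $|q|<1$, $$\sum_{n=0}^{\infty}\sigma_{e}\mathrm{Mex}(n)\,q^n=\frac{(-q;q)_\infty}{(q;q)_\infty}\lim_{z\to 4q} z \left(F_2'(z)-q^2F_2'(q^2z)\right),$$ where $$F_2(z)=\sum_{n=0}^{\infty}\frac{q^{2n(n-1)}z^n}{(-q;q^2)_n(-q^2;q^2)_n}$$ and $F_2'$ denotes the derivative of $F_2$ with respect to its argument $z$ (so $F_2'(q^2z)$ is $F_2'$ evaluated at $q^2z$).
   Context: An overpartition of a non-negative integer $n$ is a partition of $n$ (a finite non-increasing sequence of positive integers with sum $n$) in which the first occurrence of each distinct part may or may not be overlined; the empty overpartition is the only overpartition of $0$. Let $\bar{P}(n)$ be the set of all overpartitions of $n$. For $\lambda\in\bar P(n)$, $\mathrm{Mex}(\lambda)$ is the smallest positive integer that does not occur as a part of $\lambda$, whether overlined or non-overlined (so $\mathrm{Mex}$ of the empty overpartition is $1$). Let $\mathrm{Mex}_e(\lambda)=\mathrm{Mex}(\lambda)$ if $\mathrm{Mex}(\lambda)$ is even, and $\mathrm{Mex}_e(\lambda)=0$ otherwise. Define $\sigma_e\mathrm{Mex}(n)=\sum_{\lambda\in\bar P(n)}\mathrm{Mex}_e(\lambda)$. For complex $a,q$ with $|q|<1$, $(a;q)_\infty=\prod_{k=0}^{\infty}(1-aq^k)$ and $(a;q)_n=\prod_{k=0}^{n-1}(1-aq^k)$; in particular $(a;q^2)_n=\prod_{k=0}^{n-1}(1-aq^{2k})$. The function $F_2(z)$ is the basic hypergeometric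 series ${}_1\phi_2(q^2;-q,-q^2;q^2,z)$. Convention: $q^0=1$. *)

(* Defs.v *)
From HB Require Import structures.
From mathcomp Require Import all_boot all_order all_algebra.
From mathcomp Require Import complex.
From mathcomp Require Import all_classical all_reals all_analysis.

Set Implicit Arguments.
Unset Strict Implicit.
Unset Printing Implicit Defensive.

Import Order.TTheory GRing.Theory Num.Theory.
Import numFieldNormedType.Exports.

Local Open Scope classical_set_scope.
Local Open Scope nat_scope.

(* An overpartition is the list of its parts, in the order in which they are  *)
(* written; (k, true) is the overlined part k and (k, false) the              *)
(* non-overlined one. If x is immediately followed by y then either y is a    *)
(* smaller part, hence the first occurrence of its value and free to be       *)
(* overlined, or y repeats the value of x and must not be overlined.          *)
Definition overpart_rel (x y : nat * bool) : bool :=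
  (y.1 < x.1) || (y.1 == x.1) && ~~ y.2.

Definition is_overpartition (l : seq (nat * bool)) : bool :=
  sorted overpart_rel l && all (fun k => 0 < k) (unzip1 l).

Definition overpartitions (n : nat) : set (seq (nat * bool)) :=
  [set l | is_overpartition l /\ sumn (unzip1 l) = n].

Lemma mex_exists (l : seq (nat * bool)) :
  exists m, (0 < m) && (m \notin unzip1 l).
Proof.
exists (sumn (unzip1 l)).+1 => /=; apply/negP => /perm_to_rem/perm_sumn H.
by have := leqnn (sumn (unzip1 l)); rewrite {1}H /= addSn ltnNge leq_addr.
Qed.

Definition Mex (l : seq (nat * bool)) : nat := ex_minn (mex_exists l).

Definition Mex_e (l : seq (nat * bool)) : nat :=
  if odd (Mex l) then 0 else Mex l.

(* A sum over a set is meaningful only when its support is finite.            *)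
Lemma finite_overpartitions (n : nat) : finite_set (overpartitions n).
Proof.
pose T := {k : 'I_n.+1 & k.-tuple ('I_n.+1 * bool)}.
pose f (t : T) := [seq (val x.1, x.2) | x <- tagged t].
apply: (@sub_finite_set _ _ (f @` [set: T])); last exact/finite_image/finite_finset.
move=> l [/andP[_ pos] sum_l].
have le_size (s : seq nat) : all (fun k => 0 < k) s -> size s <= sumn s.
  elim: s => //= x s IHs /andP[x0 /IHs]; exact: (@leq_add 1 _ x).
have size_l : size l < n.+1.
  by rewrite ltnS -sum_l -(size_map fst); exact: le_size.
pose s := [seq ((inord x.1 : 'I_n.+1), x.2) | x <- l].
have size_s : size s == Ordinal size_l by rewrite size_map.
exists (existT (fun k : 'I_n.+1 => k.-tuple ('I_n.+1 * bool)) (Ordinal size_l)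
  (Tuple size_s)) => //.
rewrite /f /= /s -map_comp -[RHS]map_id; apply/eq_in_map => -[k b] kl /=.
rewrite inordK // ltnS -sum_l.
have : k \in unzip1 l by apply/mapP; exists (k, b).
by move=> /perm_to_rem/perm_sumn ->; exact: leq_addr.
Qed.

Definition sigma_e_Mex (n : nat) : nat :=
  \big[addn/0]_(l \in overpartitions n) Mex_e l.

Local Open Scope ring_scope.

(* The complex numbers over R, packed as an algebraically closed number field *)
(* so that the library's topology of an abstract number field applies.        *)
Definition Cplx (R : realType) : numClosedFieldType := R[i].

Section QSeries.
Variable R : realType.
Implicit Types a q z : Cplx R.

Definition qpoch a q (n : nat) : Cplx R := \prod_(k < n) (1 - a * q ^+ k).

Definition qpoch_inf a q : Cplx R := lim (qpoch a q n @[n --> \oo]).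

Definition F2 q z : Cplx R :=
  lim (series (fun n => q ^+ (2 * n * (n - 1)) * z ^+ n
         / (qpoch (- q) (q ^+ 2) n * qpoch (- q ^+ 2) (q ^+ 2) n)) @ \oo).

End QSeries.

(* Main.v *)
(** The overpartitions with Mex equal to [2m] use each of the parts
    [1, ..., 2m-1], avoid [2m], and are unconstrained above [2m]; a used part
    [k] contributes [2q^k/(1-q^k)] and an unconstrained one
    [(1+q^k)/(1-q^k)].  Hence their generating function is
    [(-q;q)_oo/(q;q)_oo * 2^(2m-1) q^(m(2m-1)) (1-q^(2m)) / (-q;q)_(2m)].
    The factors after [(-q;q)_oo/(q;q)_oo], multiplied by [2m] and summed over
    [m], give the value at [z = 4q] of
    [z (F2'(z) - q^2 F2'(q^2 z)) = sum_n n (1-q^(2n)) a_n z^n], where [a_n] are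
    the coefficients of the entire series [F2].  All interchanges of limits
    are instances of Tannery's theorem: parts are first bounded by [2M], which
    makes the products finite, and then [M] tends to infinity. *)

Require Import Defs.
From HB Require Import structures.
From mathcomp Require Import all_boot all_order all_algebra.
From mathcomp Require Import complex finmap.
From mathcomp Require Import all_classical all_reals all_analysis.
From mathcomp Require Import ring zify.

Set Implicit Arguments.
Unset Strict Implicit.
Unset Printing Implicit Defensive.

Import Order.TTheory GRing.Theory Num.Theory.
Import numFieldNormedType.Exports.

Local Open Scope classical_set_scope.
Local Open Scope ring_scope.

(** * Absolutely summable series *)

Section AbsSummable.
Variable K : numFieldType.
Implicit Types (x y z : K) (u v g : nat -> K).

Definition abs_summable u := exists M : K, forall n, \sum_(k < n) `|u k| <= M.

(* Proofs work over an abstract field with this property because unification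
   unfolds the concrete field [Cplx R] and diverges. *)
Definition abs_complete := forall u, abs_summable u -> cvgn (series u).

Lemma le_abs_summable u v : (forall n, `|u n| <= `|v n|) -> abs_summable v -> abs_summable u.
Proof.
move=> uv [M vM]; exists M => n; apply: le_trans (vM n).
by apply: ler_sum => i _; exact: uv.
Qed.

(** The partial sums increase, so each lies below a later one within distance 1 of the limit. *)
Lemma cvg_abs_summable u : (forall n, 0 <= u n) -> cvgn (series u) -> abs_summable u.
Proof.
move=> u0 /cvg_ex[l /cvgrPdist_lt /(_ 1 ltr01)] [m _ um].
exists (`|l| + 1) => n.
apply: (@le_trans _ _ (series u (maxn m n))).
  rewrite /series /= -(big_mkord xpredT (fun k => `|u k|)).
  rewrite [leRHS](big_cat_nat _ (n := n)) ?leq_maxr //=.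
  under eq_bigr do rewrite ger0_norm //.
  by rewrite lerDl sumr_ge0.
have H : 0 <= series u (maxn m n) by rewrite /series /= sumr_ge0.
rewrite -(ger0_norm H) -[X in `|X|](subrK l) addrC.
apply: le_trans (ler_normD _ _) _; rewrite lerD2l ltW //.
by rewrite distrC; apply: um; rewrite /= leq_maxl.
Qed.

Lemma series_dist u v m n : (m <= n)%N -> (forall k, `|u k| <= v k) ->
  `|series u n - series u m| <= series v n - series v m.
Proof.
move=> mn uv; rewrite !sub_series_geq //.
apply: le_trans (ler_norm_sum _ _ _) _.
by apply: ler_sum.
Qed.

(** The bound depends only on the majorant [v], hence is uniform over all [u] below it. One [e]
    replaces [l] and one replaces [m] by a far partial sum; the third is the hypothesis on
    [series v N]. *)
Lemma series_tail u v (l m : K) N e :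
  (forall k, `|u k| <= v k) -> series u @ \oo --> l -> series v @ \oo --> m ->
  0 < e -> `|m - series v N| < e -> `|l - series u N| < e + e + e.
Proof.
move=> uv ul vm e0 vN.
move/cvgrPdist_lt: ul => /(_ e e0) ul; move/cvgrPdist_lt: vm => /(_ e e0) vm.
have [n [Nn lun mvn]] : exists n, [/\ (N <= n)%N, `|l - series u n| < e & `|m - series v n| < e].
  near \oo => n; exists n; split.
  - by near: n; exists N.
  - by near: n; exact: ul.
  - by near: n; exact: vm.
rewrite -[l](subrK (series u n)) -addrA.
apply: le_lt_trans (ler_normD _ _) _; rewrite -addrA ltrD //.
apply: le_lt_trans (series_dist Nn uv) _.
have -> : series v n - series v N = `|series v n - series v N|.
  by rewrite ger0_norm // (le_trans (normr_ge0 _) (series_dist Nn uv)).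
rewrite -[series v n](subrK m) -addrA.
apply: le_lt_trans (ler_normD _ _) _; rewrite ltrD // distrC //.
Unshelve. all: by end_near.
Qed.

Hypothesis absK : abs_complete.

(** Up to [N] the partial sums converge as finite sums; beyond [N] the tails of [f t] and of [l] are
    both controlled by the tail of [g], uniformly in [t]. *)
Lemma tannery (T : Type) (F : set_system T) {FF : ProperFilter F}
    (f : T -> nat -> K) (l : nat -> K) g :
    abs_summable g ->
    (\forall t \near F, forall n, `|f t n| <= `|g n|) ->
    (forall n, f t n @[t --> F] --> l n) ->
  limn (series (f t)) @[t --> F] --> limn (series l).
Proof.
move=> sg fg fl.
have sgn : abs_summable (fun n => `|g n|) by apply: le_abs_summable sg => n; rewrite normr_id.
(* The limit inherits the bound: otherwise some [f t n] would come closer to [l n] than the gap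
   between the norms of [l n] and [g n]. *)
have lg n : `|l n| <= `|g n|.
  rewrite real_leNgt ?normr_real //; apply/negP; rewrite -subr_gt0 => e0.
  move/cvgrPdist_lt: (fl n) => /(_ _ e0) fle.
  have [t [ft lt]] : exists t, `|f t n| <= `|g n| /\ `|l n - f t n| < `|l n| - `|g n|.
    have := filter_ex (filterI fg fle).
    by move=> [t [/(_ n) ? ?]]; exists t.
  have := ler_ltD ft lt; rewrite [ltRHS]addrC subrK addrC => /(le_lt_trans (ler_normD _ _)).
  by rewrite subrK ltxx.
have sl : abs_summable l by exact: le_abs_summable sg.
have /cvg_ex[G gG] := absK sgn.
apply/cvgrPdist_lt => e e0.
(* Each of the two tails costs three of these and the finite sums cost one, seven eighths of [e] in
   all. *)
have d0 : 0 < e / 8 by rewrite divr_gt0.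
move/cvgrPdist_lt: (gG) => /(_ _ d0) [N _ /(_ N (leqnn N)) /= GN].
have /cvg_ex[L lL] := absK sl.
have fN : series (f t) N @[t --> F] --> series l N.
  rewrite /series /=; apply: (cvg_big (@add_continuous K)) => i _.
  exact: fl.
move/cvgrPdist_lt: fN => /(_ _ d0) fN.
rewrite (cvg_lim _ lL) //.
near=> t.
have ft : forall n, `|f t n| <= `|g n| by near: t.
have /cvg_ex[m tm] : cvgn (series (f t)).
  by apply: absK; exact: le_abs_summable sg.
rewrite (cvg_lim _ tm) //.
have H1 := series_tail lg lL gG d0 GN.
have H2 := series_tail ft tm gG d0 GN.
have H3 : `|series l N - series (f t) N| < e / 8 by near: t.
have -> : L - m = (L - series l N) + (series l N - series (f t) N) - (m - series (f t) N).
  by rewrite opprB addrA addrA !subrK.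
apply: le_lt_trans (ler_normB _ _) _.
apply: le_lt_trans (lerD (ler_normD _ _) (lexx _)) _.
apply: lt_trans (ltrD (ltrD H1 H3) H2) _.
have -> : e / 8 + e / 8 + e / 8 + e / 8 + (e / 8 + e / 8 + e / 8) = e - e / 8.
  by field.
by rewrite ltrBlDr ltrDl.
Unshelve. all: by end_near.
Qed.
End AbsSummable.

(** * Absolute convergence over the complex numbers *)

Section ComplexComplete.
Variable R : realType.
Implicit Types (x : Cplx R) (u : nat -> Cplx R).

Lemma cplx_ReD x y : complex.Re (x + y) = complex.Re x + complex.Re y.
Proof. by case: x y => [a b] [c d]. Qed.

Lemma cplx_ImD x y : complex.Im (x + y) = complex.Im x + complex.Im y.
Proof. by case: x y => [a b] [c d]. Qed.

Lemma cplx_series_Re u n :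
  complex.Re (series u n) = series (fun k => complex.Re (u k)) n.
Proof. exact: (big_morph _ cplx_ReD). Qed.

Lemma cplx_series_Im u n :
  complex.Im (series u n) = series (fun k => complex.Im (u k)) n.
Proof. exact: (big_morph _ cplx_ImD). Qed.

Lemma cplx_norm_ge x : `|complex.Re x| <= complex.Re `|x| /\ `|complex.Im x| <= complex.Re `|x|.
Proof.
rewrite normc_def /= -!sqrtr_sqr; split; apply: ler_wsqrtr.
  by rewrite lerDl sqr_ge0.
by rewrite lerDr sqr_ge0.
Qed.

Lemma cplx_norm_le x :
  `|x| <= real_complex R (`|complex.Re x| + `|complex.Im x|).
Proof.
rewrite normc_def lecR -[leRHS]ger0_norm ?addr_ge0 // -(sqrtr_sqr (_ + _)).
apply: ler_wsqrtr; rewrite sqrrD !real_normK ?num_real // addrAC.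
by rewrite lerDl mulrn_wge0 // mulr_ge0.
Qed.

(** Every epsilon of the complex topology is thereby a real number, to which convergence in [R]
    applies. *)
Lemma cplx_ltP x : 0 < x -> x = real_complex R (complex.Re x) /\ 0 < complex.Re x.
Proof. by case: x => [a b]; rewrite ltcE /= => /andP[/eqP-> ?]. Qed.

Lemma cplx_cvg u (a b : R) :
    (complex.Re (u n) @[n --> \oo] --> a) ->
    (complex.Im (u n) @[n --> \oo] --> b) ->
  u @ \oo --> (Complex a b : Cplx R).
Proof.
move=> ua ub; apply/cvgrPdist_lt => e /cplx_ltP[-> e0].
have e2 : 0 < complex.Re e / 2 by rewrite divr_gt0.
move/cvgrPdist_lt: ua => /(_ _ e2) ua; move/cvgrPdist_lt: ub => /(_ _ e2) ub.
near=> n; apply: le_lt_trans (cplx_norm_le _) _; rewrite ltcR [ltRHS]splitr.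
have Hn : u n = Complex (complex.Re (u n)) (complex.Im (u n)) by case: (u n).
rewrite Hn; apply: ltrD; [near: n; exact: ua | near: n; exact: ub].
Unshelve. all: by end_near.
Qed.

Lemma Cplx_abs_complete : abs_complete (Cplx R).
Proof.
move=> u [M uM].
(* Serves for both coordinates: the series of absolute values increases and is bounded by the real
   part of [M]. *)
have key (f : Cplx R -> R) : (forall x, `|f x| <= complex.Re `|x|) ->
    cvgn (series (fun n => f (u n))).
  move=> fle; apply: normed_cvg => /=.
  apply: nondecreasing_is_cvgn.
    apply/nondecreasing_seqP => n.
    rewrite /= /series /= [leRHS]big_nat_recr //= lerDl.
    exact: normr_ge0.
  exists (complex.Re M) => _ [n _ <-].
  rewrite /= /series /= big_mkord.
  apply: (@le_trans _ _ (\sum_(k < n) complex.Re `|u k|)).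
    by apply: ler_sum => i _; exact: fle.
  rewrite -(big_morph _ cplx_ReD (erefl : complex.Re (0 : Cplx R) = 0)).
  by have := uM n; rewrite lecE => /andP[].
have /cvg_ex[a ua] := key (@complex.Re R) (fun x => (cplx_norm_ge x).1).
have /cvg_ex[b ub] := key (@complex.Im R) (fun x => (cplx_norm_ge x).2).
apply/cvg_ex; exists (Complex a b : Cplx R); apply: cplx_cvg.
  by under eq_fun do rewrite cplx_series_Re.
by under eq_fun do rewrite cplx_series_Im.
Qed.

End ComplexComplete.

(** * Entire power series *)

Lemma norm_nat_le_exp2 (K : numDomainType) n : `|n%:R : K| <= `|2 ^+ n : K|.
Proof. by rewrite -natrX !normr_nat ler_nat ltnW // ltn_expl. Qed.

Section EntireSeries.
Variable K : numFieldType.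
Hypothesis absK : abs_complete K.
Implicit Types (x y z q : K) (u v a : nat -> K).

Lemma cvg_exp (T : Type) (F : set_system T) {FF : Filter F} (f : T -> K) z n :
  f t @[t --> F] --> z -> f t ^+ n @[t --> F] --> z ^+ n.
Proof.
move=> fz; elim: n => [|n IHn]; first by under eq_fun do rewrite expr0; exact: cvg_cst.
rewrite exprS (_ : (fun t => f t ^+ n.+1) = f \* (fun t => f t ^+ n)).
  exact: (cvgM fz IHn).
by apply/funext => t; rewrite /= exprS.
Qed.

Lemma near_abs_summable u v :
  (\forall n \near \oo, `|u n| <= `|v n|) -> abs_summable v -> abs_summable u.
Proof.
move=> [N _ uv] [M vM]; exists (\sum_(k < N) `|u k| + M) => n.
apply: (@le_trans _ _ (\sum_(k < N + n) `|u k|)).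
  rewrite -!(big_mkord xpredT (fun k => `|u k|)) addnC.
  by rewrite [leRHS](big_cat_nat (n := n)) ?leq_addr //= lerDl sumr_ge0.
rewrite big_split_ord /= lerD2l.
apply: le_trans (vM (N + n)%N).
rewrite big_split_ord /= -[leLHS]add0r lerD ?sumr_ge0 //.
by apply: ler_sum => i _; apply: uv; rewrite /= leq_addr.
Qed.

Lemma geometric_summable x : `|x| < 1 -> abs_summable (fun n => x ^+ n).
Proof.
move=> x1; exists (1 - `|x|)^-1 => n.
under eq_bigr do rewrite normrX.
have d0 : 0 < 1 - `|x| by rewrite subr_gt0.
have H : (1 - `|x|) * \sum_(i < n) `|x| ^+ i = 1 - `|x| ^+ n.
  by rewrite -[LHS]opprK -mulNr opprB -subrX1 opprB.
by rewrite -(ler_pM2l d0) H mulfV ?lt0r_neq0 // lerBlDr lerDl exprn_ge0.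
Qed.

Lemma abs_summableZ x u : abs_summable u -> abs_summable (fun n => x * u n).
Proof.
move=> [M uM]; exists (`|x| * M) => n.
by under eq_bigr do rewrite normrM; rewrite -mulr_sumr ler_wpM2l.
Qed.

Lemma cvg_geometric0 x : `|x| < 1 -> x ^+ n @[n --> \oo] --> (0 : K).
Proof. by move=> /geometric_summable/absK/cvg_series_cvg_0. Qed.

Definition entire a := forall z, abs_summable (fun n => a n * z ^+ n).

Definition psum a z : K := limn (series (fun n => a n * z ^+ n)).

(** A geometric factor only moves the evaluation point, and [a] is summable at every point. *)
Lemma entire_le a (b : nat -> K) z :
  (forall n, `|b n| <= `|a n * z ^+ n|) -> entire a -> entire b.
Proof.
move=> ba ea w; apply: le_abs_summable (ea (z * w)) => n.
by rewrite exprMn mulrA !normrM ler_wpM2r // -normrM.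
Qed.

Lemma entire_natM a : entire a -> entire (fun n => n%:R * a n).
Proof.
apply: (@entire_le _ _ 2) => n.
by rewrite mulrC [leLHS]normrM [leRHS]normrM (ler_wpM2l (normr_ge0 _) (norm_nat_le_exp2 _ n)).
Qed.

(** Comparison at radius [|z| + 1]: this is at least 1, so raising the exponent from [i] to [i.+1]
    does not decrease the power. *)
Lemma entire_deriv a : entire a -> entire (fun n => n.+1%:R * a n.+1).
Proof.
move=> /entire_natM ea z.
have [M aM] := ea (`|z| + 1); exists M => n.
apply: le_trans (aM n.+1); rewrite [leRHS]big_ord_recl -[leLHS]add0r.
rewrite lerD //; apply: ler_sum => i _; rewrite /= normrM [leRHS]normrM.
rewrite ler_wpM2l // !normrX (ger0_norm (_ : 0 <= `|z| + 1)) ?addr_ge0 //.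
rewrite exprS (@le_trans _ _ ((`|z| + 1) ^+ i)) //.
  by rewrite lerXn2r ?nnegrE ?addr_ge0 ?lerDl.
by rewrite ler_peMl ?exprn_ge0 ?addr_ge0 ?lerDr.
Qed.

Lemma psum_cvg a z : entire a -> series (fun n => a n * z ^+ n) @ \oo --> psum a z.
Proof. by move=> /(_ z)/absK. Qed.

Lemma psum_continuous a z : entire a -> psum a w @[w --> z] --> psum a z.
Proof.
move=> ea.
have za n : a n * w ^+ n @[w --> z] --> a n * z ^+ n.
  have idz : (fun w : K => w) w @[w --> z] --> z by exact: cvg_id.
  have FF : Filter (nbhs z) by exact: nbhs_filter.
  have zn := @cvg_exp _ _ FF _ _ n idz.
  exact: (cvgMl_tmp (a := a n) zn).
have z1 : `|z| < `|z| + 1 by rewrite ltrDl.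
refine (tannery absK (ea (`|z| + 1)) _ za).
near=> w => n; rewrite normrM [leRHS]normrM ler_wpM2l // !normrX.
rewrite (ger0_norm (_ : 0 <= `|z| + 1)) ?addr_ge0 //.
rewrite lerXn2r ?nnegrE ?addr_ge0 //.
near: w; exact: (@cvgr_norm_le _ _ _ (nbhs z) (nbhs_filter z) id z (@cvg_id _ _) _ z1).
Unshelve. all: by end_near.
Qed.

Lemma psum_derive1 a z : entire a ->
  derive1 (psum a) z = psum (fun n => n.+1%:R * a n.+1) z.
Proof.
move=> ea; apply: cvg_lim => //.
(* Terms of the difference quotient: factoring [(h + z)^(n+1) - z^(n+1)] cancels [h], and what
   remains is a polynomial in [h], ready for Tannery's theorem at [h = 0]. *)
pose f h n := a n.+1 * \sum_(i < n.+1) (h + z) ^+ (n - i) * z ^+ i.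
have near_psum : \forall h \near (0 : K)^',
    limn (series (f h)) = h^-1 *: (psum a (h + z) - psum a z).
  near=> h.
  have h0 : h != 0 by near: h; exact: nbhs_dnbhs_neq.
  apply: cvg_lim => //.
  rewrite -[X in X @ _](_ : (fun n =>
      h^-1 * (series (fun n => a n * (h + z) ^+ n) n.+1 -
              series (fun n => a n * z ^+ n) n.+1)) = _).
    apply: cvgMl_tmp; apply: cvgB.
      rewrite (cvg_shiftS (series (fun n => a n * (h + z) ^+ n))).
      exact: psum_cvg.
    rewrite (cvg_shiftS (series (fun n => a n * z ^+ n))).
    exact: psum_cvg.
  apply/funext => n; rewrite /series /= -sumrB big_nat_recl //= !expr0 subrr add0r.
  rewrite mulr_sumr; apply: eq_bigr => i _.
  by rewrite -mulrBr subrXX /= addrK /f mulrCA mulKf.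
apply: cvg_trans (near_eq_cvg near_psum) _.
have zn n : f ^~ n h @[h --> 0^'] --> n.+1%:R * a n.+1 * z ^+ n.
  rewrite /f mulrAC mulrC; apply: cvgMl_tmp.
  rewrite (_ : n.+1%:R * z ^+ n = \sum_(i < n.+1) z ^+ (n - i) * z ^+ i); last first.
    under eq_bigr => i _ do rewrite -exprD (subnK (leq_ord i)).
    by rewrite sumr_const card_ord mulr_natl.
  apply: (cvg_big (@add_continuous K)) => i _.
  apply: cvgMr_tmp; apply: cvg_exp.
  rewrite -[X in _ --> X]add0r; apply: cvgD; last exact: cvg_cst.
  exact: nbhs_dnbhs.
(* For [|h| < 1] each of the [n.+1] products in [f h n] is at most [(|z| + 1)^n] in norm. *)
refine (tannery absK (entire_deriv ea (`|z| + 1)) _ zn).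
near=> h => n.
have h1 : `|h| < 1 by near: h; exact: dnbhs0_lt.
have z1 : 0 <= `|z| + 1 by rewrite addr_ge0.
rewrite /f mulrAC [leRHS]normrM normrM mulrC ler_wpM2r //.
apply: le_trans (ler_norm_sum _ _ _) _.
apply: (@le_trans _ _ (\sum_(i < n.+1) (`|z| + 1) ^+ n)); last first.
  by rewrite sumr_const card_ord normrM normr_nat normrX (ger0_norm z1) mulr_natl.
apply: ler_sum => i _; rewrite normrM !normrX.
rewrite (_ : (`|z| + 1) ^+ n = (`|z| + 1) ^+ (n - i) * (`|z| + 1) ^+ i); last first.
  by rewrite -exprD (subnK (leq_ord i)).
rewrite ler_pM ?exprn_ge0 //.
  rewrite lerXn2r ?nnegrE // (le_trans (ler_normD _ _)) // addrC lerD2l ltW //.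
by rewrite lerXn2r ?nnegrE // lerDl.
Unshelve. all: by end_near.
Qed.

End EntireSeries.

(** * Infinite products *)

Section InfiniteProducts.
Variable K : numFieldType.
Hypothesis absK : abs_complete K.
Implicit Types (x y z q : K) (u v a : nat -> K).

Lemma abs_summable_tail u (e : K) : abs_summable u -> 0 < e ->
  exists N, forall n, \sum_(k < n) `|u (N + k)%N| < e.
Proof.
move=> su e0.
have e2 : 0 < e / 2 by rewrite divr_gt0.
have /absK/cvg_ex[l] : abs_summable (fun n => `|u n|).
  by apply: le_abs_summable su => n; rewrite normr_id.
move=> /cvgrPdist_lt/(_ _ e2)[N _ uN]; exists N => n.
have -> : \sum_(k < n) `|u (N + k)%N| =
    series (fun n => `|u n|) (N + n)%N - series (fun n => `|u n|) N.
  by rewrite /series /= !big_mkord big_split_ord /= [RHS]addrC addKr.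
rewrite -[ltLHS]ger0_norm; last first.
  by rewrite sub_series_geq ?leq_addr // sumr_ge0.
rewrite -[X in `|X - _|](subrK l) -addrA (le_lt_trans (ler_normD _ _)) //.
by rewrite [ltRHS]splitr ltrD // ?uN //= distrC uN //= leq_addr.
Qed.

(** The Weierstrass product inequality. *)
Lemma prod_ge_1Bsum u n : (forall k, 0 <= u k <= 1) ->
  1 - \sum_(k < n) u k <= \prod_(k < n) (1 - u k) <= 1.
Proof.
move=> x01; elim: n => [|n /andP[IH1 IH2]]; first by rewrite !big_ord0 subr0 lexx.
have /andP[x0 x1] := x01 n.
have p0 : 0 <= \prod_(k < n) (1 - u k).
  by rewrite prodr_ge0 // => i _; rewrite subr_ge0; have /andP[] := x01 i.
rewrite !big_ord_recr /= mulrBr mulr1 opprD addrA lerB //=; last by rewrite ler_piMl.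
by rewrite (le_trans _ IH2) // lerBlDr lerDl mulr_ge0.
Qed.

(** From some [N] on the tail sums stay below 1/2, so the Weierstrass inequality keeps the tail
    products above 1/2; the first [N] factors form a fixed positive constant. *)
Lemma prod_1B_gt0 u : abs_summable u -> (forall k, `|u k| < 1) ->
  exists2 d : K, 0 < d & forall n, d <= \prod_(k < n) (1 - `|u k|).
Proof.
move=> su u1.
have h0 : (0 : K) < 1 / 2 by rewrite divr_gt0.
have [N uN] := abs_summable_tail su h0.
have f0 k : 0 < 1 - `|u k| by rewrite subr_gt0.
pose d := \prod_(k < N) (1 - `|u k|).
have d0 : 0 < d by rewrite prodr_gt0.
have half n : 1 / 2 <= \prod_(k < n) (1 - `|u (N + k)%N|).
  have /(_ _)/andP[|+ _] := @prod_ge_1Bsum (fun k => `|u (N + k)%N|) n.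
    by move=> k; rewrite normr_ge0 ltW.
  apply: le_trans; rewrite lerBrDr -lerBrDl (le_trans (ltW (uN n))) //.
  by rewrite [X in _ <= X - _]splitr addrK.
have dN n : d * (1 / 2) <= \prod_(k < N + n) (1 - `|u k|).
  by rewrite big_split_ord /=; exact: ler_wpM2l (ltW d0) _ _ (half n).
exists (d * (1 / 2)); first by rewrite mulr_gt0.
(* All factors are at most 1, so the product of length [N + n] bounds the one of length [n] from
   below, also when [n < N]. *)
move=> n; apply: le_trans (dN n) _.
rewrite addnC big_split_ord /= ler_piMr //; first by rewrite prodr_ge0 // => i _; exact: ltW.
by rewrite prodr_ile1 // => i _; rewrite ltW //= lerBlDr lerDl.
Qed.

(* The telescoping series of the partial products is dominated by [|u n| / d],
   where [d] is a lower bound of the products of the [1 - |u k|]. *)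
Lemma prod_cvg u : abs_summable u -> (forall k, `|u k| < 1) ->
  exists2 l : K, l != 0 & \prod_(k < n) (1 + u k) @[n --> \oo] --> l.
Proof.
move=> su u1; have [d d0 dP] := prod_1B_gt0 su u1.
pose p n := \prod_(k < n) (1 + u k).
have pge n : d <= `|p n|.
  apply: le_trans (dP n) _; rewrite normr_prod ler_prod // => i _.
  rewrite subr_ge0 ltW //= lerBlDr.
  by rewrite -[leLHS]normr1 -{1}(addrK (u i) 1) (le_trans (ler_normB _ _)).
(* Since [(1 + |u|)(1 - |u|) <= 1] for each factor, the lower bound [d] yields this upper bound. *)
have ple n : `|p n| <= d^-1.
  rewrite -[leRHS]mul1r ler_pdivlMr //.
  apply: le_trans (ler_wpM2l (normr_ge0 _) (dP n)) _.
  rewrite normr_prod -big_split /= prodr_ile1 // => i _.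
  apply/andP; split; first by rewrite mulr_ge0 // subr_ge0 ltW.
  apply: (@le_trans _ _ ((1 + `|u i|) * (1 - `|u i|))).
    apply: ler_wpM2r; first by rewrite subr_ge0 ltW.
    by rewrite (le_trans (ler_normD _ _)) // normr1.
  by rewrite mulrC -subr_sqr expr1n lerBlDr lerDl exprn_ge0.
have tel n : series (fun k => p k.+1 - p k) n = p n - 1.
  rewrite /series /= telescope_sumr //.
  by congr (_ - _); rewrite /p big_ord0.
have sp : abs_summable (fun k => p k.+1 - p k).
  apply: le_abs_summable (abs_summableZ d^-1 su) => n.
  rewrite /p big_ord_recr /= mulrDr mulr1 addrC addKr !normrM ler_wpM2r //.
  by rewrite (ger0_norm (_ : 0 <= d^-1)) ?ple // invr_ge0 ltW.
have /cvg_ex[l pl] := absK sp.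
have pl1 : p n @[n --> \oo] --> l + 1.
  rewrite (_ : p = fun n => series (fun k => p k.+1 - p k) n + 1); last first.
    by apply/funext => n; rewrite tel subrK.
  by apply: cvgD pl _; exact: cvg_cst.
exists (l + 1) => //; apply/negP => /eqP l0.
move: pl1; rewrite l0 => /cvgrPdist_lt/(_ _ d0)[n _ /(_ n (leqnn n))] /=.
by rewrite sub0r normrN => /(le_lt_trans (pge n)); rewrite ltxx.
Qed.

Lemma qpoch_prod_cvg (b q : K) : `|q| < 1 -> `|b| < 1 ->
  exists2 l : K, l != 0 & \prod_(k < n) (1 - b * q ^+ k) @[n --> \oo] --> l.
Proof.
move=> q1 b1; apply: (@prod_cvg (fun k => - (b * q ^+ k))).
  apply: le_abs_summable (abs_summableZ b (geometric_summable q1)) => n.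
  by rewrite normrN.
move=> k; rewrite normrN normrM normrX.
by apply: le_lt_trans b1; rewrite ler_piMr // exprn_ile1 // ltW.
Qed.

(** The n-th term is the n-th power of [r^(2(n-1)) D z], whose base tends to 0 and so is eventually
    at most 1/2 in norm. *)
Lemma superexp_entire (r D : K) : `|r| < 1 ->
  entire (fun n => r ^+ (2 * n * (n - 1)) * D ^+ n).
Proof.
move=> r1 z.
have half1 : `|2^-1 : K| < 1 by rewrite normfV normr_nat invf_lt1 ?ltr1n.
apply: near_abs_summable (geometric_summable half1).
have h0 : (0 : K) < 2^-1 by rewrite invr_gt0.
have rD : r ^+ n * (D * z) @[n --> \oo] --> (0 : K).
  by rewrite -(mul0r (D * z)); apply: cvgMr_tmp; exact: cvg_geometric0.
move/cvgr0_norm_le: rD => /(_ _ h0)[N _ rN].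
exists N.+1 => // n /= Nn.
rewrite -mulrA -exprMn mulnAC exprM -exprMn [leLHS]normrX [leRHS]normrX.
rewrite lerXn2r ?nnegrE // (ger0_norm (_ : 0 <= 2^-1)) ?invr_ge0 ?ler0n //.
apply: le_trans (rN (2 * (n - 1))%N _); last by rewrite /=; lia.
by [].
Qed.
End InfiniteProducts.

(** * Counting overpartitions *)

Section Overpartitions.
Local Open Scope nat_scope.

(** Reduces the recurrences between counts to pointwise identities between indicators. *)
Lemma count_lincomb (T : eqType) (s : seq T) (a b c : pred T) x y :
  {in s, forall i, a i = x * b i + y * c i :> nat} ->
  count a s = x * count b s + y * count c s.
Proof.
elim: s => [|i s IHs] abc /=; first by rewrite !muln0.
rewrite IHs => [|j js]; last by rewrite abc // inE js orbT.
by rewrite abc ?mem_head // !mulnDr; lia.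
Qed.

Definition ovp (n : nat) : seq (seq (nat * bool)) :=
  enum_fset (fset_set (overpartitions n)).

Lemma mem_ovp n l :
  (l \in ovp n) = is_overpartition l && (sumn (unzip1 l) == n).
Proof.
rewrite /ovp -[LHS]/(l \in fset_set (overpartitions n)).
rewrite in_fset_set; last exact: finite_overpartitions.
apply/idP/andP; rewrite inE /overpartitions /=.
  by move=> [-> /eqP].
by move=> [-> /eqP].
Qed.

Lemma uniq_ovp n : uniq (ovp n). Proof. exact: fset_uniq. Qed.

Lemma overpart_rel_trans : transitive overpart_rel.
Proof. by move=> [y yb] [x xb] [z zb]; rewrite /overpart_rel /=; lia. Qed.

Lemma is_overpartition_cons x l : is_overpartition (x :: l) =
  [&& 0 < x.1, all (overpart_rel x) l & is_overpartition l].
Proof.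
rewrite /is_overpartition /= (path_sortedE overpart_rel_trans).
by case: (0 < _); rewrite ?andbF //= -!andbA.
Qed.

(** Prepending [x] is a bijection; as [overpart_rel] is transitive, sortedness relates [x] to the
    whole remaining list and not only to its head. *)
Lemma count_ovp_cons (a : pred (seq (nat * bool))) x n : 0 < x.1 ->
  count (fun l => (ohead l == Some x) && a l) (ovp (x.1 + n)) =
  count (fun l => all (overpart_rel x) l && a (x :: l)) (ovp n).
Proof.
move=> x0; rewrite -!size_filter -[RHS](size_map (cons x)).
apply: perm_size; apply: uniq_perm; first exact/filter_uniq/uniq_ovp.
  by rewrite map_inj_uniq ?filter_uniq ?uniq_ovp // => l l' [].
move=> l; rewrite mem_filter; apply/idP/mapP.
  case: l => [|y l] //= /andP[/andP[/eqP[->] al]].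
  rewrite mem_ovp is_overpartition_cons /= eqn_add2l => /andP[/and3P[_ xl ol] sl].
  by exists l => //; rewrite mem_filter xl al mem_ovp ol.
move=> [l']; rewrite mem_filter mem_ovp => /andP[/andP[xl al] /andP[ol /eqP sl]] ->.
by rewrite /= eqxx al mem_ovp is_overpartition_cons x0 xl ol /= sl eqxx.
Qed.

Lemma count_ovp_head_lt (a : pred (seq (nat * bool))) x n : n < x.1 ->
  count (fun l => (ohead l == Some x) && a l) (ovp n) = 0.
Proof.
move=> nx; apply/eqP; rewrite -leqn0 leqNgt -has_count; apply/hasP => -[[|y l]] //=.
rewrite mem_ovp /= => /andP[_ /eqP sl] /andP[/eqP[yx]].
by move: nx; rewrite -sl yx ltnNge leq_addr.
Qed.

Section Pattern.
(* [t k b] tells whether the part k is allowed to occur ([b = true]), resp. to be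
   absent ([b = false]). *)
Variable t : nat -> bool -> bool.

Definition pattern N (l : seq (nat * bool)) :=
  all (fun k => t k (k \in unzip1 l)) (iota 1 N).

Definition bounded N (l : seq (nat * bool)) := all (leq^~ N) (unzip1 l).

Definition npattern N n := count (fun l => bounded N l && pattern N l) (ovp n).

(* Only overpartitions to which a further part [N.+1] can be prepended: [N.+1]
   may already occur in them, but not overlined. *)
Definition nextensible N n :=
  count (fun l => all (overpart_rel (N.+1, false)) l && pattern N l) (ovp n).

(** Here [N.+1] is the largest part, and [pattern N] does not constrain it. *)
Definition nproper N n :=
  count (fun l => [&& N.+1 \in unzip1 l, bounded N.+1 l & pattern N l]) (ovp n).

Lemma pattern_cons N b l : pattern N ((N.+1, b) :: l) = pattern N l.
Proof.
apply: eq_in_all => k; rewrite mem_iota add1n ltnS inE => /andP[_ kN].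
by rewrite ltn_eqF.
Qed.

Lemma npattern0 n : npattern 0 n = (n == 0).
Proof.
rewrite /npattern (_ : (n == 0) = ([::] \in ovp n)); last first.
  by rewrite mem_ovp /= eq_sym.
rewrite -(count_uniq_mem _ (uniq_ovp n)).
apply: eq_in_count => -[|[[|k] b] l] //.
by rewrite mem_ovp is_overpartition_cons.
Qed.

(** Either [N.+1] occurs and is the largest part, or it is absent and all parts are at most [N]. *)
Lemma npatternS N n :
  npattern N.+1 n = t N.+1 true * nproper N n + t N.+1 false * npattern N n.
Proof.
apply: count_lincomb => l _.
rewrite /pattern -(addn1 N) iotaD all_cat /= add1n andbT addn1.
have bE : bounded N l = bounded N.+1 l && (N.+1 \notin unzip1 l).
  rewrite /bounded; elim: (unzip1 l) => //= k s ->.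
  rewrite inE negb_or (_ : (k <= N) = (k <= N.+1) && (N.+1 != k)); last by lia.
  by case: (_ <= _); case: (_ != _); rewrite ?andbF.
rewrite bE; case: (N.+1 \in unzip1 l); case: bounded; case: all => //=;
  rewrite ?andbF ?muln0 ?addn0 ?muln1 //.
Qed.

Lemma rel_bounded N b l : all (overpart_rel (N, b)) l -> bounded N l.
Proof.
rewrite /bounded all_map; apply: sub_all => -[k c].
by rewrite /overpart_rel /= => /orP[/ltnW|/andP[/eqP->]].
Qed.

Lemma bounded_rel N b l : bounded N l -> all (overpart_rel (N.+1, b)) l.
Proof.
by rewrite /bounded all_map; apply: sub_all => -[k c]; rewrite /overpart_rel /= ltnS => ->.
Qed.

(** Parts never increase along the list, so [N.+1] cannot occur behind a smaller head. *)
Lemma head_proper N l : is_overpartition l -> bounded N.+1 l ->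
  (N.+1 \in unzip1 l) = (ohead l == Some (N.+1, true)) || (ohead l == Some (N.+1, false)).
Proof.
case: l => [|[k b] l] //=.
rewrite is_overpartition_cons => /and3P[_ kl _] /andP[/= kN _].
rewrite inE.
have -> : (N.+1 == k) || (N.+1 \in unzip1 l) = (k == N.+1).
  rewrite eq_sym; case: (eqVneq k N.+1) => //= kN1.
  apply/negP => /mapP[[y c] /(allP kl)]; rewrite /overpart_rel /= => + Ny.
  by rewrite -Ny; lia.
by rewrite !(inj_eq Some_inj) !xpair_eqE; case: (k == _); case: (b).
Qed.

Lemma nproper_split N n (a := fun l => bounded N.+1 l && pattern N l) :
  nproper N n = count (fun l => (ohead l == Some (N.+1, true)) && a l) (ovp n) +
    count (fun l => (ohead l == Some (N.+1, false)) && a l) (ovp n).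
Proof.
rewrite -[X in X + _]mul1n -[X in _ + X]mul1n; apply: count_lincomb => l.
rewrite mem_ovp => /andP[ol _]; rewrite /a !mul1n.
case: (boolP (bounded _ _)) => [bl|]; rewrite ?andbF // (head_proper ol bl).
case: eqVneq => [->|_]; case: (pattern N l); rewrite ?andbF //= ?andbT.
by rewrite (inj_eq Some_inj) xpair_eqE andbF.
Qed.

(** The deleted leading part [N.+1] could be overlined or not, whence the factor 2; further copies
    of it may remain, none of them overlined. *)
Lemma nproper_shift N n : nproper N (N.+1 + n) = 2 * nextensible N n.
Proof.
pose a l := bounded N.+1 l && pattern N l.
have ext b : count (fun l => (ohead l == Some (N.+1, b)) && a l) (ovp (N.+1 + n)) =
    nextensible N n.
  rewrite (count_ovp_cons a (x := (N.+1, b))) //.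
  apply: eq_count => l /=; rewrite /a pattern_cons /bounded /= leqnn.
  (* The relation ignores the mark of its left argument, so both forms are convertible. *)
  rewrite -[all (overpart_rel (N.+1, false)) l]/(all (overpart_rel (N.+1, b)) l).
  case: (boolP (all _ l)) => // rl.
  by move: (rel_bounded rl); rewrite /bounded => ->.
rewrite mul2n -addnn -{1}(ext true) -(ext false).
by rewrite nproper_split.
Qed.

Lemma nproper_lt N n : n < N.+1 -> nproper N n = 0.
Proof.
move=> nN; pose a l := bounded N.+1 l && pattern N l.
have ext b : count (fun l => (ohead l == Some (N.+1, b)) && a l) (ovp n) = 0.
  exact: (@count_ovp_head_lt a (N.+1, b)).
by rewrite nproper_split !ext.
Qed.

Lemma nextensible_split N n : nextensible N n = npattern N n +
  count (fun l => (ohead l == Some (N.+1, false)) &&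
    (all (overpart_rel (N.+1, false)) l && pattern N l)) (ovp n).
Proof.
rewrite -[X in X + _]mul1n -[X in _ + X]mul1n; apply: count_lincomb => l.
rewrite mem_ovp => /andP[ol _]; rewrite !mul1n.
case: (pattern N l); rewrite ?andbF // !andbT.
case: (boolP (bounded N l)) => [bl|nbl].
  rewrite (bounded_rel _ bl); case: l bl {ol} => [|[k b] l] //= /andP[/= kN _].
  by case: eqVneq => // -[kE _]; rewrite kE ltnn in kN.
case: (boolP (all _ _)) => [rl|]; rewrite ?andbF // andbT.
case: l ol nbl rl => [|[k b] l] //.
rewrite is_overpartition_cons => /and3P[_ /rel_bounded kl _] /= + /andP[+ _].
rewrite /overpart_rel /= ltnS => nbl /orP[kN|/andP[/eqP-> /negbTE->]]; last by rewrite eqxx.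
case/negP: nbl; rewrite /bounded /= kN /=.
by apply: sub_all kl => i /leq_trans; exact.
Qed.

(** Either [N.+1] does not occur, or one non-overlined copy of it is deleted. In generating
    functions this becomes division by [1 - q^(N+1)]. *)
Lemma nextensible_shift N n :
  nextensible N (N.+1 + n) = npattern N (N.+1 + n) + nextensible N n.
Proof.
rewrite nextensible_split; congr (_ + _).
rewrite (count_ovp_cons _ (x := (N.+1, false))) //.
apply: eq_count => l /=; rewrite pattern_cons /overpart_rel /= eqxx orbT /=.
by case: (all _ _).
Qed.

Lemma nextensible_lt N n : n < N.+1 -> nextensible N n = npattern N n.
Proof.
move=> nN; rewrite nextensible_split.
by rewrite (@count_ovp_head_lt _ (N.+1, false)) // addn0.
Qed.

End Pattern.

(** * Mex as a pattern of parts, and truncated sums *)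

Definition mex_pattern (j k : nat) (b : bool) : bool :=
  if k < j then b else (k == j) ==> ~~ b.

Lemma MexP l m : reflect
  [/\ 0 < m, m \notin unzip1 l & forall k, 0 < k < m -> k \in unzip1 l] (Mex l == m).
Proof.
rewrite /Mex; case: ex_minnP => d /andP[d0 dl] dmin.
apply: (iffP eqP) => [<-|[m0 ml mmin]].
  split=> // k /andP[k0]; apply: contraTT => kl; rewrite -leqNgt.
  by apply: dmin; rewrite k0.
apply/eqP; rewrite eqn_leq dmin ?m0 //= leqNgt.
by apply/negP => dm; move: dl; rewrite mmin // d0.
Qed.

Lemma pattern_mex N j l : 0 < j <= N -> pattern (mex_pattern j) N l = (Mex l == j).
Proof.
move=> /andP[j0 jN]; apply/allP/MexP => [pat|[_ jl minj] k].
  split=> // [|k /andP[k0 kj]].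
    by have := pat j; rewrite mem_iota j0 add1n ltnS jN /mex_pattern ltnn eqxx; exact.
  have := pat k; rewrite mem_iota k0 add1n ltnS (leq_trans (ltnW kj) jN) /mex_pattern kj.
  by apply.
rewrite mem_iota /mex_pattern => /andP[k0 _].
case: ltngtP => //= [kj|->] //.
by apply: minj; rewrite k0.
Qed.

Lemma part_le_sumn (l : seq (nat * bool)) k : k \in unzip1 l -> k <= sumn (unzip1 l).
Proof. by move=> /perm_to_rem/perm_sumn ->; exact: leq_addr. Qed.

Lemma Mex_le l : Mex l <= (sumn (unzip1 l)).+1.
Proof.
rewrite /Mex; case: ex_minnP => m _; apply => /=.
by apply/negP => /part_le_sumn; rewrite ltnn.
Qed.

Lemma sigma_e_MexE n : sigma_e_Mex n = \sum_(l <- ovp n) Mex_e l.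
Proof. by rewrite /sigma_e_Mex fsbig_finite //; exact: finite_overpartitions. Qed.

Definition even_part j := if odd j then 0 else j.

(** Bounding both the parts and the mex by [N] makes the generating function a finite sum of finite
    products; the index [j.+1] is the value of [Mex]. *)
Definition sigma_trunc N n :=
  \sum_(j < N) even_part j.+1 * npattern (mex_pattern j.+1) N n.

Lemma sigma_truncE N n : sigma_trunc N n =
  \sum_(l <- ovp n | bounded N l && (Mex l <= N)) Mex_e l.
Proof.
have -> : sigma_trunc N n = \sum_(j < N) \sum_(l <- ovp n)
    even_part j.+1 * (bounded N l && pattern (mex_pattern j.+1) N l).
  apply: eq_bigr => j _; rewrite /npattern -sum1_count big_mkcond big_distrr /=.
  by apply: eq_bigr => l _; case: ifP.
rewrite exchange_big [RHS]big_mkcond; apply: eq_bigr => l _ /=.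
case: (bounded N l) => /=; last by rewrite big1 // => j _; rewrite muln0.
under eq_bigr => j _ do rewrite pattern_mex ?ltn_ord //.
have M0 : 0 < Mex l by have /MexP[] := eqxx (Mex l).
case: leqP => MN.
  have MN1 : (Mex l).-1 < N by rewrite prednK.
  rewrite (bigD1 (Ordinal MN1)) //= prednK // eqxx muln1 big1 ?addn0 // => j.
  rewrite -val_eqE /= => jM; case: eqVneq; rewrite ?muln0 // => Mj.
  by rewrite Mj /= eqxx in jM.
rewrite big1 // => j _; case: eqVneq; rewrite ?muln0 // => Mj.
by move: MN; rewrite Mj ltnS leqNgt ltn_ord.
Qed.

Lemma sigma_trunc_le N n : sigma_trunc N n <= sigma_e_Mex n.
Proof.
rewrite sigma_truncE sigma_e_MexE big_mkcond; apply: leq_sum => l _.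
by case: ifP.
Qed.

(** Overpartitions of [n] have parts at most [n] and mex at most [n.+1], so the truncation discards
    nothing. *)
Lemma sigma_trunc_eq N n : n < N -> sigma_trunc N n = sigma_e_Mex n.
Proof.
move=> nN; rewrite sigma_truncE sigma_e_MexE big_seq_cond [RHS]big_seq.
apply: eq_bigl => l; apply: andb_idr; rewrite mem_ovp => /andP[_ /eqP sl].
rewrite (leq_trans (Mex_le l)) ?sl // andbT.
apply/allP => k /part_le_sumn; rewrite sl => kn.
exact: leq_trans kn (ltnW nN).
Qed.

End Overpartitions.

(** * Generating functions *)

Section GeneratingFunctions.
Variable K : numFieldType.
Hypothesis absK : abs_complete K.
Implicit Types (q : K) (c d s : nat -> nat) (v w : K -> K).

(** The order of [K] is partial, so the bound uses the norm of [l], which is comparable with the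
    partial sums; a partial sum above it would keep all later ones away from [l]. *)
Lemma series_le_norm_lim (u : nat -> K) (l : K) n : (forall k, 0 <= u k) ->
  series u @ \oo --> l -> series u n <= `|l|.
Proof.
move=> u0 ul.
have S0 m : 0 <= series u m by rewrite /series /= sumr_ge0.
rewrite -(ger0_norm (S0 n)) real_leNgt ?normr_real //.
apply/negP; rewrite -subr_gt0 => e0.
move/cvgrPdist_lt: ul => /(_ _ e0)[N _ ul].
have := ul (maxn N n) (leq_maxl _ _); apply/negP.
rewrite -real_leNgt ?normr_real ?rpredB ?normr_real //.
rewrite lerBlDr; apply: (@le_trans _ _ `|series u (maxn N n)|).
  rewrite !ger0_norm // /series /= [leRHS](big_cat_nat (n := n)) ?leq_maxr //=.
  by rewrite lerDl sumr_ge0.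
rewrite -[X in `|X|](subrK l) (le_trans (ler_normD _ _)) //.
by rewrite lerD2r distrC.
Qed.

Definition has_gf c v := forall q, `|q| < 1 ->
  series (fun n => (c n)%:R * q ^+ n) @ \oo --> v q.

(** The coefficients are nonnegative, so convergence at [|q|] is absolute convergence at [q]. *)
Lemma has_gf_summable c v q : has_gf c v -> `|q| < 1 ->
  abs_summable (fun n => (c n)%:R * q ^+ n).
Proof.
move=> cv q1.
have : abs_summable (fun n => (c n)%:R * `|q| ^+ n).
  apply: cvg_abs_summable => [n|]; first by rewrite mulr_ge0 // exprn_ge0.
  by apply/cvg_ex; exists (v `|q|); apply: cv; rewrite normr_id.
by apply: le_abs_summable => n; rewrite !normrM !normrX normr_id.
Qed.

Lemma eq_has_gf c v w : (forall q, `|q| < 1 -> v q = w q) -> has_gf c v -> has_gf c w.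
Proof. by move=> vw cv q q1; rewrite -vw //; exact: cv. Qed.

Lemma has_gf_lincomb c d v w x y : has_gf c v -> has_gf d w ->
  has_gf (fun n => x * c n + y * d n)%N (fun q => x%:R * v q + y%:R * w q).
Proof.
move=> cv dw q q1.
rewrite (_ : series _ = fun N => x%:R * series (fun n => (c n)%:R * q ^+ n) N +
    y%:R * series (fun n => (d n)%:R * q ^+ n) N).
  by apply: cvgD; apply: cvgMl_tmp; [exact: cv|exact: dw].
apply/funext => N; rewrite /series /= !mulr_sumr -big_split; apply: eq_bigr => i _ /=.
by rewrite natrD !natrM mulrDl !mulrA.
Qed.

Lemma series_shift (f : nat -> K) p N :
  series f (N + p)%N = series f p + series (fun n => f (p + n)%N) N.
Proof. by rewrite /series /= !big_mkord addnC big_split_ord. Qed.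

Lemma has_gf_shift c d v p : has_gf c v -> (forall n, d (p + n)%N = c n) ->
  (forall n, (n < p)%N -> d n = 0%N) -> has_gf d (fun q => q ^+ p * v q).
Proof.
move=> cv dc d0 q q1; rewrite -(cvg_shiftn p).
rewrite (_ : [sequence _]_n = fun N => q ^+ p * series (fun n => (c n)%:R * q ^+ n) N).
  by apply: cvgMl_tmp; exact: cv.
apply/funext => N; rewrite /= series_shift.
rewrite {1}/series /= big_mkord big1 ?add0r => [|i _]; last by rewrite d0 // mul0r.
rewrite /series /= mulr_sumr; apply: eq_bigr => i _.
by rewrite dc exprD mulrCA.
Qed.

(** The recurrence reads [S = C + q^p S] for the generating functions; convergence of [S] has to be
    established before solving for it. *)
Lemma has_gf_geometric c s v p : (0 < p)%N -> has_gf c v ->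
  (forall n, s (p + n)%N = c (p + n) + s n)%N ->
  (forall n, (n < p)%N -> s n = c n) -> has_gf s (fun q => v q / (1 - q ^+ p)).
Proof.
move=> p0 cv sc sc0 q q1.
pose S (x : K) N := series (fun n => (s n)%:R * x ^+ n) N.
pose C (x : K) N := series (fun n => (c n)%:R * x ^+ n) N.
have SC x N : S x (N + p)%N = C x (N + p)%N + x ^+ p * S x N.
  rewrite /S /C !series_shift -addrA; congr (_ + _).
    by rewrite /series /= !big_mkord; apply: eq_bigr => i _; rewrite sc0.
  rewrite /series /= mulr_sumr -big_split; apply: eq_bigr => i _ /=.
  by rewrite sc natrD mulrDl [x ^+ (p + i)]exprD [X in _ = _ + X]mulrCA.
have qp1 : `|q| ^+ p < 1 by rewrite exprn_ilt1 // -lt0n.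
have [M CM] := has_gf_summable cv q1.
(* At [|q|] the partial sums increase, so [SC] gives [(1 - |q|^p) S_N <= C_(N+p) <= M]. *)
have sS : abs_summable (fun n => (s n)%:R * q ^+ n).
  exists (M / (1 - `|q| ^+ p)) => N.
  have t0 n : 0 <= (s n)%:R * `|q| ^+ n by rewrite mulr_ge0 // exprn_ge0.
  rewrite (_ : \sum_(_ < _) _ = S `|q| N); last first.
    rewrite /S /series /= big_mkord; apply: eq_bigr => i _.
    by rewrite normrM normrX normr_nat.
  rewrite ler_pdivlMr ?subr_gt0 // mulrBr mulr1 lerBlDr [_ * _ ^+ p]mulrC.
  apply: (@le_trans _ _ (S `|q| (N + p)%N)).
    rewrite /S /series /= [leRHS](big_cat_nat (n := N)) ?leq_addr //=.
    by rewrite lerDl sumr_ge0.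
  rewrite SC lerD2r; apply: le_trans (CM (N + p)%N).
  rewrite /C /series /= big_mkord; apply: ler_sum => i _.
  by rewrite normrM normrX normr_nat.
have /cvg_ex[l Sl] := absK sS.
suff -> : v q / (1 - q ^+ p) = l by [].
have qp0 : 1 - q ^+ p != 0.
  rewrite subr_eq0; apply/eqP => q1E; move: qp1; rewrite -normrX -q1E normr1.
  by rewrite ltxx.
(* It remains to pass to the limit in [SC]: [l = v q + q^p l]. *)
apply: (mulIf qp0); rewrite divfK // mulrBr mulr1; apply/eqP.
rewrite eq_sym subr_eq; apply/eqP.
have H1 : S q (N + p)%N @[N --> \oo] --> l.
  by rewrite (cvg_shiftn p (S q)).
apply: (cvg_unique _ H1) => //=.
rewrite (_ : (fun N => S q (N + p)%N) = fun N => C q (N + p)%N + q ^+ p * S q N); last first.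
  by apply/funext => N; rewrite SC.
rewrite [l * _]mulrC; apply: cvgD.
  by rewrite (cvg_shiftn p (C q)); exact: cv.
exact: cvgMl_tmp.
Qed.

Lemma npattern_gf (t : nat -> bool -> bool) N : has_gf (npattern t N) (fun q =>
  \prod_(k < N) ((t k.+1 true)%:R * (2 * q ^+ k.+1 / (1 - q ^+ k.+1)) + (t k.+1 false)%:R)).
Proof.
elim: N => [q q1|N IHN].
  rewrite big_ord0 -(cvg_shiftS (series _)).
  rewrite (_ : [sequence _]_n = fun=> 1); first exact: cvg_cst.
  apply/funext => n; rewrite /series /= big_nat_recl // npattern0 mul1r expr0.
  by rewrite big1 ?addr0 // => i _; rewrite npattern0 mul0r.
have ext := has_gf_geometric (ltn0Sn N) IHN (nextensible_shift t N) (@nextensible_lt t N).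
(* Doubling, written as a linear combination with second coefficient 0. *)
have ext2 := @has_gf_lincomb _ _ _ _ 2 0 ext ext.
have prop := has_gf_shift ext2 _ (@nproper_lt t N).
have {}prop := prop (fun n => etrans (nproper_shift t N n) (esym (addn0 _))).
have {prop} := @has_gf_lincomb _ _ _ _ (t N.+1 true) (t N.+1 false) prop IHN.
rewrite (_ : npattern t N.+1 = fun n => (t N.+1 true * nproper t N n +
    t N.+1 false * npattern t N n)%N); last by apply/funext => n; rewrite npatternS.
apply: eq_has_gf => q q1; rewrite big_ord_recr /= mul0r addr0.
by move: ((1 - q ^+ N.+1)^-1) (q ^+ N.+1) (\prod_(_ < _) _) => x y z; ring.
Qed.

End GeneratingFunctions.

(** * Coefficients of [F2] and the combination of its derivatives *)

Section MexIdentity.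
Variable K : numFieldType.
Hypothesis absK : abs_complete K.
Implicit Types (q z : K).

Definition F2den q n : K :=
  (\prod_(k < n) (1 - - q * (q ^+ 2) ^+ k)) * \prod_(k < n) (1 - - q ^+ 2 * (q ^+ 2) ^+ k).

(** The two products run over the odd and the even exponents and interleave to [(-q;q)_(2n)]. *)
Lemma F2denE q n : F2den q n = \prod_(k < 2 * n) (1 + q ^+ k.+1).
Proof.
rewrite /F2den; elim: n => [|n IHn]; first by rewrite !big_ord0 mulr1.
rewrite mulnS !big_ord_recr /= -IHn !mulNr !opprK -exprM -exprS -exprD add2n.
by rewrite mulrACA !mulrA.
Qed.

Lemma subr1X_neq0 q n : `|q| < 1 -> 1 - q ^+ n.+1 != 0.
Proof.
move=> q1; have : `|q ^+ n.+1| < 1 by rewrite normrX exprn_ilt1.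
by apply: contraTneq => /subr0_eq <-; rewrite normr1 ltxx.
Qed.

Lemma addr1X_neq0 q n : `|q| < 1 -> 1 + q ^+ n.+1 != 0.
Proof.
move=> q1; have : `|q ^+ n.+1| < 1 by rewrite normrX exprn_ilt1.
by apply: contraTneq => /eqP; rewrite addrC addr_eq0 => /eqP->; rewrite normrN normr1 ltxx.
Qed.

Definition F2coef q n : K := q ^+ (2 * n * (n - 1)) / F2den q n.

(** Each of the [2n] factors of the denominator has norm at least [1 - |q|], which leaves a
    superexponentially small majorant. *)
Lemma F2coef_entire q : `|q| < 1 -> entire (F2coef q).
Proof.
move=> q1; have d0 : 0 < 1 - `|q| by rewrite subr_gt0.
have r1 : `| `|q| | < 1 by rewrite normr_id.
apply: (@entire_le _ _ _ 1) (superexp_entire absK (((1 - `|q|) ^- 2)) r1) => n.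
have Dn : `|((1 - `|q|) ^- 2) ^+ n| = ((1 - `|q|) ^+ (2 * n))^-1.
  by rewrite exprVn -exprM ger0_norm // invr_ge0 exprn_ge0 // ltW.
rewrite expr1n mulr1 /F2coef [leLHS]normrM [leRHS]normrM Dn !normrX normr_id.
rewrite ler_wpM2l ?exprn_ge0 // normfV lef_pV2 ?posrE ?exprn_gt0 //.
  rewrite F2denE normr_prod -[leLHS](_ : \prod_(k < 2 * n) (1 - `|q|) = _); last first.
    by rewrite prodr_const card_ord.
  apply: ler_prod => k _; rewrite ltW //= -[q in leRHS]opprK.
  rewrite lerBlDr (@le_trans _ _ (`|1 + q ^+ k.+1| + `|q ^+ k.+1|)) //.
    by rewrite -[leLHS](@normr1 K) -{1}(addrK (q ^+ k.+1) 1) (le_trans (ler_normB _ _)) // opprK.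
  by rewrite opprK lerD2l normrX exprS ler_piMr ?exprn_ile1 // ltW.
rewrite F2denE normr_gt0; apply/prodf_neq0 => k _; exact: addr1X_neq0.
Qed.

Definition mex_coef q n : K := n%:R * (1 - q ^+ (2 * n)) * F2coef q n.

Lemma entireB (a b : nat -> K) : entire a -> entire b -> entire (fun n => a n - b n).
Proof.
move=> ea eb z; have [M aM] := ea z; have [N bN] := eb z; exists (M + N) => n.
apply: le_trans (lerD (aM n) (bN n)); rewrite -big_split; apply: ler_sum => i _.
by rewrite mulrBl ler_normB.
Qed.

Lemma entire_scale (a : nat -> K) w : entire a -> entire (fun n => a n * w ^+ n).
Proof.
move=> ea z; apply: le_abs_summable (ea (w * z)) => n.
by rewrite exprMn mulrA.
Qed.

Lemma mex_coefE q :
  mex_coef q = fun n => n%:R * F2coef q n - n%:R * F2coef q n * (q ^+ 2) ^+ n.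
Proof. by apply/funext => n; rewrite /mex_coef -exprM; ring. Qed.

Lemma mex_coef_entire q : `|q| < 1 -> entire (mex_coef q).
Proof.
move=> q1; have ea := entire_natM (F2coef_entire q1).
by rewrite mex_coefE; apply: entireB => //; exact: entire_scale.
Qed.

Lemma psum_cvgE (a : nat -> K) z l : series (fun n => a n * z ^+ n) @ \oo --> l -> psum a z = l.
Proof. exact: cvg_lim. Qed.

Lemma psum_shift (b : nat -> K) z : entire (fun n => b n.+1) -> b 0%N = 0 ->
  z * psum (fun n => b n.+1) z = psum b z.
Proof.
move=> eb1 b0; apply/esym/psum_cvgE.
rewrite -(cvg_shiftS (series _)).
rewrite (_ : [sequence _]_n = fun N => z * series (fun n => b n.+1 * z ^+ n) N).
  by apply: cvgMl_tmp; exact: (psum_cvg absK).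
apply/funext => N; rewrite /series /= big_nat_recl // b0 mul0r add0r mulr_sumr.
by apply: eq_bigr => i _; rewrite exprS; ring.
Qed.

(** The operator [z d/dz] multiplies the n-th coefficient by [n]. In the second term [z] joins
    [q^2], so the same rule holds at [q^2 z] and brings in [q^(2n)]. *)
Lemma deriv_combination q z : `|q| < 1 ->
  z * (derive1 (psum (F2coef q)) z - q ^+ 2 * derive1 (psum (F2coef q)) (q ^+ 2 * z)) =
  psum (mex_coef q) z.
Proof.
move=> q1; have ea := F2coef_entire q1; have en := entire_natM ea.
rewrite !psum_derive1 //.
have sh w : w * psum (fun n => n.+1%:R * F2coef q n.+1) w =
    psum (fun n => n%:R * F2coef q n) w.
  apply: (@psum_shift (fun n => n%:R * F2coef q n)) => //; last by rewrite mul0r.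
  exact: entire_deriv.
rewrite mulrBr sh mulrA [z * _]mulrC sh mex_coefE; apply/esym/psum_cvgE.
rewrite (_ : series _ = fun N =>
    series (fun n => n%:R * F2coef q n * z ^+ n) N -
    series (fun n => n%:R * F2coef q n * (q ^+ 2 * z) ^+ n) N).
  by apply: cvgB; exact: (psum_cvg absK).
apply/funext => N; rewrite /series /= -sumrB; apply: eq_bigr => i _.
by rewrite [(_ * z) ^+ i]exprMn mulrBl !mulrA.
Qed.

End MexIdentity.

(** * Evaluation of the truncated sums and passage to the limit *)

Section MexLimit.
Variable K : numFieldType.
Hypothesis absK : abs_complete K.
Implicit Types (q z : K).

Definition ovp_prod q n : K := \prod_(k < n) ((1 + q ^+ k.+1) / (1 - q ^+ k.+1)).

Lemma sigma_trunc_gf N : has_gf (sigma_trunc N) (fun q : K =>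
  \sum_(j < N) (even_part j.+1)%:R * \prod_(k < N)
    ((mex_pattern j.+1 k.+1 true)%:R * (2 * q ^+ k.+1 / (1 - q ^+ k.+1)) +
     (mex_pattern j.+1 k.+1 false)%:R)).
Proof.
move=> q q1.
rewrite (_ : series _ = fun M => \sum_(j < N) (even_part j.+1)%:R *
    series (fun n => (npattern (mex_pattern j.+1) N n)%:R * q ^+ n) M).
  apply: (cvg_big (@add_continuous K)) => j _; apply: cvgMl_tmp.
  exact: (npattern_gf absK).
apply/funext => M; rewrite /series /=.
under [RHS]eq_bigr do rewrite mulr_sumr.
rewrite exchange_big; apply: eq_bigr => i _ /=.
rewrite /sigma_trunc natr_sum mulr_suml; apply: eq_bigr => j _.
by rewrite natrM mulrA.
Qed.

(** Above [i.+1] both sides have the same factors, as [2x/(1-x) + 1 = (1+x)/(1-x)]; at [i.+1] the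
    left factor is 1, and below it is [2x/(1-x)]. *)
Lemma mex_prod q i N : `|q| < 1 -> (i < N)%N ->
  \prod_(k < N) ((mex_pattern i.+1 k.+1 true)%:R * (2 * q ^+ k.+1 / (1 - q ^+ k.+1)) +
     (mex_pattern i.+1 k.+1 false)%:R) =
  ovp_prod q N * (\prod_(k < i) (2 * q ^+ k.+1) * (1 - q ^+ i.+1) /
    \prod_(k < i.+1) (1 + q ^+ k.+1)).
Proof.
move=> q1 iN; rewrite -(subnKC iN); move: (N - i.+1)%N => n.
have p1 k := subr1X_neq0 k q1; have p2 k := addr1X_neq0 k q1.
rewrite /ovp_prod !big_split_ord /= mulrAC; congr (_ * _); last first.
  apply: eq_bigr => k _.
  have H1 : ((i.+1 + k).+1 < i.+1)%N = false by lia.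
  have H2 : ((i.+1 + k).+1 == i.+1)%N = false by lia.
  rewrite /mex_pattern H1 H2 /= mul1r.
  by have := p1 (i.+1 + k)%N; move: (q ^+ _) => x x1; field.
rewrite !big_ord_recr /= /mex_pattern ltnn eqxx /= mul0r add0r mulr1.
under eq_bigr => k _ do rewrite ltnS ltn_ord addr0 mul1r.
rewrite !big_split /= !prodfV.
have d1 : \prod_(k < i) (1 - q ^+ k.+1) != 0 by apply/prodf_neq0 => k _.
have d2 : \prod_(k < i) (1 + q ^+ k.+1) != 0 by apply/prodf_neq0 => k _.
have := p1 i; have := p2 i; move: d1 d2.
move: (\prod_(k < i) (1 - q ^+ k.+1)) (\prod_(k < i) (1 + q ^+ k.+1)) => x y.
move: (\prod_(k < i) _) (\prod_(k < i) _) (q ^+ i.+1) => a b c x0 y0 c1 c2.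
by field; rewrite x0 y0 c1 c2.
Qed.

(** With [n = m + 1] the exponents [1 + ... + (2n-1)] add up to [2n(n-1) + n]: this is where the
    point [4q] comes from. The extra 2 is taken from the weight [Mex = 2n]. *)
Lemma prod_2exp q m : 2 * \prod_(k < (2 * m).+1) (2 * q ^+ k.+1) =
  q ^+ (2 * m.+1 * (m.+1 - 1)) * (4 * q) ^+ m.+1.
Proof.
elim: m => [|m IHm]; first by rewrite big_ord_recr big_ord0 /=; ring.
rewrite (_ : (2 * m.+1).+1 = (2 * m).+3); last by lia.
rewrite big_ord_recr /= big_ord_recr /= -[_ * _ * _]mulrA [LHS]mulrA IHm mulrA.
rewrite (_ : (2 * m.+2 * (m.+2 - 1) =
  2 * m.+1 * (m.+1 - 1) + ((2 * m).+2 + (2 * m).+2))%N); last by nia.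
rewrite !exprD [(4 * q) ^+ m.+2]exprS [q ^+ (2 * m).+3]exprS.
by move: ((4 * q) ^+ _) (q ^+ (2 * m).+2) (q ^+ _) => x y z; ring.
Qed.

Lemma sum_even_part (f : nat -> K) M :
  \sum_(j < 2 * M) (even_part j.+1)%:R * f j =
  \sum_(m < M) (2 * m.+1)%:R * f (2 * m).+1.
Proof.
elim: M => [|M IHM]; first by rewrite !big_ord0.
rewrite mulnS !big_ord_recr /= IHM -addrA; congr (_ + _).
by rewrite /even_part /= !mul2n odd_double /= mul0r add0r doubleS.
Qed.

Lemma sigma_trunc_value q M : `|q| < 1 ->
  \sum_(j < 2 * M) (even_part j.+1)%:R * \prod_(k < 2 * M)
    ((mex_pattern j.+1 k.+1 true)%:R * (2 * q ^+ k.+1 / (1 - q ^+ k.+1)) +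
     (mex_pattern j.+1 k.+1 false)%:R) =
  ovp_prod q (2 * M) * series (fun n => mex_coef q n * (4 * q) ^+ n) M.+1.
Proof.
move=> q1.
pose f i := ovp_prod q (2 * M) * (\prod_(k < i) (2 * q ^+ k.+1) * (1 - q ^+ i.+1) /
    \prod_(k < i.+1) (1 + q ^+ k.+1)).
transitivity (\sum_(j < 2 * M) (even_part j.+1)%:R * f j).
  by apply: eq_bigr => j _; rewrite mex_prod.
(* The term of index 0 vanishes through its factor [n]; hence [M.+1] terms of the series match [M]
   even values of the mex. *)
rewrite sum_even_part /series /= big_mkord big_ord_recl /= /mex_coef mul0r mul0r mul0r add0r.
rewrite mulr_sumr; apply: eq_bigr => m _.
rewrite /f /= /bump /= add1n /F2coef F2denE.
have := prod_2exp q m; move: (q ^+ _) (_ ^+ m.+1) => x y xy.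
rewrite (_ : (2 * m.+1 = (2 * m).+2)%N) in xy *; last by lia.
move: (\prod_(k < (2 * m).+2) _)^-1 => d.
have -> : (2 * m).+2%:R = 2 * m.+1%:R :> K by rewrite -natrM mulnS.
rewrite [x * d]mulrC [RHS](_ : _ = ovp_prod q (2 * M) *
  (m.+1%:R * (1 - q ^+ (2 * m).+2) * d * (x * y))); last by rewrite !mulrA.
rewrite -xy; move: (ovp_prod _ _) (\prod_(k < _) _) (q ^+ _) (m.+1%:R) => a b c e.
by ring.
Qed.

Lemma double_cvgy : (fun M => 2 * M)%N @ \oo --> \oo.
Proof.
move=> A [N _ AN]; exists N => // n /= Nn; apply: AN => /=.
by rewrite (leq_trans Nn) // leq_pmull.
Qed.

Lemma ovp_prod_cvg q (a b : K) :
    \prod_(k < n) (1 - - q * q ^+ k) @[n --> \oo] --> a ->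
    \prod_(k < n) (1 - q * q ^+ k) @[n --> \oo] --> b -> b != 0 ->
  ovp_prod q n @[n --> \oo] --> a / b.
Proof.
move=> pa pb b0.
rewrite (_ : ovp_prod q = fun n => (\prod_(k < n) (1 - - q * q ^+ k)) *
    (\prod_(k < n) (1 - q * q ^+ k))^-1).
  by apply: cvgM => //; exact: cvgV.
apply/funext => n; rewrite /ovp_prod big_split /= prodfV; congr (_ * _^-1).
  by apply: eq_bigr => k _; rewrite mulNr opprK exprS.
by apply: eq_bigr => k _; rewrite exprS.
Qed.

Lemma sigma_trunc_cvg q : `|q| < 1 -> exists2 c : K,
    c = lim (\prod_(k < n) (1 - - q * q ^+ k) @[n --> \oo]) /
        lim (\prod_(k < n) (1 - q * q ^+ k) @[n --> \oo]) &
    limn (series (fun n => (sigma_trunc (2 * M) n)%:R * q ^+ n)) @[M --> \oo] -->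
    c * psum (mex_coef q) (4 * q).
Proof.
move=> q1; have qN1 : `|- q| < 1 by rewrite normrN.
have [a _ pa] := qpoch_prod_cvg absK q1 qN1; have [b b0 pb] := qpoch_prod_cvg absK q1 q1.
exists (a / b); first by congr (_ / _); apply/esym/cvg_lim.
rewrite (_ : (fun M => limn _) = fun M =>
    ovp_prod q (2 * M) * series (fun n => mex_coef q n * (4 * q) ^+ n) M.+1); last first.
  apply/funext => M; rewrite -sigma_trunc_value //; apply: cvg_lim => //.
  exact: sigma_trunc_gf.
apply: cvgM.
  exact: (cvg_comp _ _ double_cvgy (ovp_prod_cvg pa pb b0)).
rewrite (cvg_shiftS (series (fun n => mex_coef q n * (4 * q) ^+ n))).
exact: (@psum_cvg _ absK _ (4 * q) (mex_coef_entire absK q1)).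
Qed.

(** No growth estimate is made: at [r = |q|] the truncated sums converge as [M] grows, hence are
    eventually bounded by [|L| + 1], and they majorize the partial sums. *)
Lemma sigma_summable q : `|q| < 1 -> abs_summable (fun n => (sigma_e_Mex n)%:R * q ^+ n).
Proof.
move=> q1; set r := `|q|; have r1 : `|r| < 1 by rewrite normr_id.
have [c _ /cvgrPdist_lt/(_ 1 ltr01)[M0 _ lM]] := sigma_trunc_cvg r1.
set L := c * _ in lM; exists (`|L| + 1) => N.
(* [M0] ensures closeness to [L], and [N] ensures that the first [N] coefficients are not affected
   by the truncation. *)
set M := maxn M0 N.
have r0 : 0 <= r by exact: normr_ge0.
have trunc_ge0 n : 0 <= (sigma_trunc (2 * M) n)%:R * r ^+ n by rewrite mulr_ge0 ?ler0n // exprn_ge0.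
have Hcvg := @sigma_trunc_gf (2 * M)%N r r1.
apply: (@le_trans _ _ (series (fun n => (sigma_trunc (2 * M) n)%:R * r ^+ n) N)).
  rewrite /series /= big_mkord; apply: ler_sum => i _.
  rewrite normrM normrX normr_nat sigma_trunc_eq // (leq_trans (ltn_ord i)) //.
  by rewrite (leq_trans (leq_maxr M0 N)) // leq_pmull.
apply: le_trans (series_le_norm_lim N trunc_ge0 Hcvg) _.
have := lM M (leq_maxl _ _); rewrite /= (cvg_lim _ Hcvg) //.
set H := \sum_(j < _) _ => LH.
rewrite -[H](subrK L) addrC (le_trans (ler_normD _ _)) // lerD2l distrC ltW //.
Qed.

(** Tannery's theorem with the full series as majorant; each coefficient is eventually constant in
    [M]. *)
Lemma sigma_trunc_cvg_sigma q : `|q| < 1 ->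
  limn (series (fun n => (sigma_trunc (2 * M) n)%:R * q ^+ n)) @[M --> \oo] -->
  limn (series (fun n => (sigma_e_Mex n)%:R * q ^+ n)).
Proof.
move=> q1.
have lim_term n : (sigma_trunc (2 * M) n)%:R * q ^+ n @[M --> \oo] -->
    (sigma_e_Mex n)%:R * q ^+ n.
  apply: cvg_near_cst; exists n.+1 => // M /= nM.
  by rewrite sigma_trunc_eq // (leq_trans nM) // leq_pmull.
refine (tannery absK (sigma_summable q1) _ lim_term).
apply: nearW => M n; rewrite !normrM ler_wpM2r // !normr_nat ler_nat.
exact: sigma_trunc_le.
Qed.

Lemma mex_generating_function q : `|q| < 1 ->
  let F := fun z : K => lim (series (fun n => q ^+ (2 * n * (n - 1)) * z ^+ n
    / ((\prod_(k < n) (1 - - q * (q ^+ 2) ^+ k)) *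
       \prod_(k < n) (1 - - q ^+ 2 * (q ^+ 2) ^+ k))) @ \oo) in
  let S := series (fun n : nat => (sigma_e_Mex n)%:R * q ^+ n) in
  let G := fun z : K =>
    z * (derive1 F z - q ^+ 2 * derive1 F (q ^+ 2 * z)) in
  [/\ cvg (S @ \oo),
      cvg (G z @[z --> (4 * q)^']) &
      lim (S @ \oo) = lim (\prod_(k < n) (1 - - q * q ^+ k) @[n --> \oo]) /
        lim (\prod_(k < n) (1 - q * q ^+ k) @[n --> \oo]) *
        lim (G z @[z --> (4 * q)^'])].
Proof.
move=> q1 F S G.
have FE : F = psum (F2coef q).
  apply/funext => z; rewrite /F /psum; congr (lim (series _ @ \oo)).
  by apply/funext => n; rewrite /F2coef /F2den mulrAC.
(* [G] is an entire power series, so its limit at [4q] is its value there. *)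
have Gl : G z @[z --> (4 * q)^'] --> psum (mex_coef q) (4 * q).
  rewrite (_ : G = psum (mex_coef q)).
    have cG := @psum_continuous _ absK _ (4 * q) (mex_coef_entire absK q1).
    by move=> A /cG; exact: nbhs_dnbhs.
  by apply/funext => z; rewrite /G FE deriv_combination.
have [c cE cl] := sigma_trunc_cvg q1.
split; first exact: absK (sigma_summable q1).
  by apply/cvg_ex; exists (psum (mex_coef q) (4 * q)).
(* The same truncated sequence has been given two limits, which therefore agree. *)
rewrite (cvg_lim _ Gl) // -cE; apply: cvg_unique (sigma_trunc_cvg_sigma q1) cl => //.
Qed.

End MexLimit.

Theorem theorem1p10 (R : realType) (q : Cplx R) (hq : `|q| < 1) :
  let S := series (fun n : nat => (sigma_e_Mex n)%:R * q ^+ n) in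
  let G := fun z : Cplx R =>
    z * (derive1 (F2 q) z - q ^+ 2 * derive1 (F2 q) (q ^+ 2 * z)) in
  [/\ cvg (S @ \oo),
      cvg (G z @[z --> (4 * q)^']) &
      lim (S @ \oo) =
        qpoch_inf (- q) q / qpoch_inf q q * lim (G z @[z --> (4 * q)^'])].
Proof. exact: (mex_generating_function (@Cplx_abs_complete R) hq). Qed.
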